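(* Let $\mathcal{A}$ and $\mathcal{B}$ be unital associative complex algebras and let $\varphi:\mathcal{A}\to\mathcal{B}$ be a homomorphism of unital algebras such that $\varphi(Z(\mathcal{A}))\subset Z(\mathcal{B})$. Then there is a unique linear mapping $\Omega^1_Z(\varphi):\Omega^1_Z(\mathcal{A})\to\Omega^1_Z(\mathcal{B})$ satisfying $$\Omega^1_Z(\varphi)(x\omega y)=\varphi(x)\,\Omega^1_Z(\varphi)(\omega)\,\varphi(y)\quad\text{for all }x,y\in\mathcal{A},\ \omega\in\Omega^1_Z(\mathcal{A}),$$ and such that $d_Z\circ\varphi=\Omega^1_Z(\varphi)\circ d_Z$.
   Context: $Z(\mathcal{A})$ denotes the center of an algebra $\mathcal{A}$. All bimodules are complex vector spaces with unital, commuting left and right actions. For a unital associative complex algebra $\mathcal{A}$, let $\Omega^1_u(\mathcal{A})\subset\mathcal{A}\otimes_{\mathbb{C}}\mathcal{A}$ be the kernel of the product map $\mathcal{A}\otimes\mathcal{A}\to\mathcal{A}$, $x\otimes y\mapsto xy$, regarded as an $(\mathcal{A},\mathcal{A})$-bimodule, and let $d_u:\mathcal{A}\to\Omega^1_u(\mathcal{A})$ be the derivation $d_u(x)=1\otimes x-x\otimes 1$. Let $[Z(\mathcal{A}),\Omega^1_u(\mathcal{A})]$ be the subbimodule of $\Omega^1_u(\mathcal{A})$ spanned by the elements $z\omega-\omega z$ with $z\in Z(\mathcal{A})$, $\omega\in\Omega^1_u(\mathcal{A})$. Set $\Omega^1_Z(\mathcal{A})=\Omega^1_u(\mathcal{A})/[Z(\mathcal{A}),\Omega^1_u(\mathcal{A})]$,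 let $p_Z:\Omega^1_u(\mathcal{A})\to\Omega^1_Z(\mathcal{A})$ be the canonical projection, and set $d_Z=p_Z\circ d_u:\mathcal{A}\to\Omega^1_Z(\mathcal{A})$, which is a derivation. *)

(* Defs.v *)
From HB Require Import structures.
From mathcomp Require Import all_boot all_order all_algebra.
From mathcomp Require Import boolp classical_sets reals.
From mathcomp Require Import complex.
From mathcomp Require Import freeg.

Set Implicit Arguments.
Unset Strict Implicit.
Unset Printing Implicit Defensive.

Import GRing.Theory.

Local Open Scope ring_scope.
Local Open Scope quotient_scope.

(* Unital associative K-algebras. The library's algType requires 1 != 0; the
   zero algebra is allowed here, which is the only difference. *)
HB.mixin Record isPzAlgebra (K : pzRingType) A of GRing.PzRing A := {
  pzscale : K -> A -> A;
  pzscaleA : forall a b x, pzscale a (pzscale b x) = pzscale (a * b) x;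
  pzscale1 : left_id 1 pzscale;
  pzscaleDr : right_distributive pzscale +%R;
  pzscaleDl : forall x, {morph pzscale^~ x : a b / a + b};
  pzscaleAl : forall a x y, pzscale a (x * y) = pzscale a x * y;
  pzscaleAr : forall a x y, pzscale a (x * y) = x * pzscale a y
}.

#[short(type="pzAlgType")]
HB.structure Definition PzAlgebra (K : pzRingType) :=
  {A of GRing.PzRing A & isPzAlgebra K A}.

(* From here on scaling in an algebra is written with the library's *:. *)
HB.instance Definition _ (K : pzRingType) (A : pzAlgType K) :=
  GRing.Zmodule_isLmodule.Build K (@PzAlgebra.sort K A)
    pzscaleA pzscale1 pzscaleDr pzscaleDl.

Lemma pz_scalerAl (K : pzRingType) (A : pzAlgType K) (a : K) (x y : A) :
  a *: (x * y) = (a *: x) * y.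
Proof. exact: pzscaleAl. Qed.

Lemma pz_scalerAr (K : pzRingType) (A : pzAlgType K) (a : K) (x y : A) :
  a *: (x * y) = x * (a *: y).
Proof. exact: pzscaleAr. Qed.

Lemma mulr_linearl (K : pzRingType) (A : pzAlgType K) (y : A) :
  linear (fun x : A => x * y).
Proof. by move=> a u v; rewrite mulrDl pz_scalerAl. Qed.

Lemma mulr_linearr (K : pzRingType) (A : pzAlgType K) (x : A) :
  linear (fun y : A => x * y).
Proof. by move=> a u v; rewrite mulrDr pz_scalerAr. Qed.

Definition center (A : pzRingType) : set A :=
  [set z | forall x : A, z * x = x * z].
Arguments center : clear implicits.

Section Submodule.
Variables (K : pzRingType) (V : lmodType K).

Definition lspan (S : set V) : {pred V} := fun v =>
  `[< forall U : {pred V}, submod_closed U -> (forall s, S s -> s \in U) ->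
        v \in U >].

Lemma lspan_submod_closed S : submod_closed (lspan S).
Proof.
split=> [|a u v /asboolP Su /asboolP Sv]; apply/asboolP => U Uc SU.
  by case: Uc.
by case: (Uc) => _; apply; [exact: Su | exact: Sv].
Qed.

Lemma mem_lspan (S : set V) s : S s -> s \in lspan S.
Proof. by move=> Ss; apply/asboolP => U _; apply. Qed.

HB.instance Definition _ S := GRing.isSubmodClosed.Build K V (lspan S)
  (lspan_submod_closed S).

End Submodule.

Section LmodQuotient.
Variables (K : pzRingType) (V : lmodType K) (W : submodClosed V).

(* Quotient.quot wants a predicate also declared closed under opposite. *)
Definition submod_pred : {pred V} := fun v => v \in W.

Lemma submod_pred_zmod_closed : zmod_closed submod_pred.
Proof. exact: (GRing.submod_closedB (submodClosedP W)). Qed.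

HB.instance Definition _ :=
  GRing.isZmodClosed.Build V submod_pred submod_pred_zmod_closed.

Definition lmod_quot := Quotient.quot submod_pred.

HB.instance Definition _ := GRing.Zmodule.on lmod_quot.

Definition lmod_pi (v : V) : lmod_quot := \pi_(Quotient.quot submod_pred) v.

Lemma lmod_piP v w : reflect (lmod_pi v = lmod_pi w) (v - w \in W).
Proof.
by rewrite -[v - w \in W]/(v - w \in submod_pred) Quotient.idealrBE; apply: eqP.
Qed.

Lemma lmod_piK (q : lmod_quot) : lmod_pi (repr (q : Quotient.quot submod_pred)) = q.
Proof. exact: reprK. Qed.

Definition lmod_quot_scale (a : K) (q : lmod_quot) : lmod_quot :=
  lmod_pi (a *: repr (q : Quotient.quot submod_pred)).

Lemma lmod_quot_scaleE a v : lmod_quot_scale a (lmod_pi v) = lmod_pi (a *: v).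
Proof.
by apply/lmod_piP; rewrite -scalerBr rpredZ //; apply/lmod_piP; rewrite lmod_piK.
Qed.

Lemma lmod_quot_scaleA a b q :
  lmod_quot_scale a (lmod_quot_scale b q) = lmod_quot_scale (a * b) q.
Proof. by rewrite -[q]lmod_piK !lmod_quot_scaleE scalerA. Qed.

Lemma lmod_quot_scale1 q : lmod_quot_scale 1 q = q.
Proof. by rewrite -[q]lmod_piK !lmod_quot_scaleE scale1r. Qed.

Lemma lmod_piD v w : lmod_pi (v + w) = lmod_pi v + lmod_pi w.
Proof. by rewrite /lmod_pi raddfD. Qed.

Lemma lmod_quot_scaleDr a p q :
  lmod_quot_scale a (p + q) = lmod_quot_scale a p + lmod_quot_scale a q.
Proof.
by rewrite -[p]lmod_piK -[q]lmod_piK -lmod_piD !lmod_quot_scaleE -lmod_piD scalerDr.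
Qed.

Lemma lmod_quot_scaleDl q a b :
  lmod_quot_scale (a + b) q = lmod_quot_scale a q + lmod_quot_scale b q.
Proof. by rewrite -[q]lmod_piK !lmod_quot_scaleE -lmod_piD scalerDl. Qed.

HB.instance Definition _ := GRing.Zmodule_isLmodule.Build K lmod_quot
  lmod_quot_scaleA lmod_quot_scale1 lmod_quot_scaleDr lmod_quot_scaleDl.

Lemma lmod_pi_is_linear : linear lmod_pi.
Proof. by move=> a v w; rewrite lmod_piD -lmod_quot_scaleE. Qed.

HB.instance Definition _ :=
  GRing.isLinear.Build K V lmod_quot *:%R lmod_pi lmod_pi_is_linear.

End LmodQuotient.

HB.mixin Record isBimodule (K : pzRingType) (A B : pzAlgType K) M
    of GRing.Lmodule K M := {
  lact : A -> M -> M;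
  ract : M -> B -> M;
  lact_linearl : forall m, linear (lact^~ m);
  lact_linearr : forall x, linear (lact x);
  ract_linearl : forall y, linear (ract^~ y);
  ract_linearr : forall m, linear (ract m);
  lact1 : forall m, lact 1 m = m;
  ract1 : forall m, ract m 1 = m;
  lactM : forall x x' m, lact (x * x') m = lact x (lact x' m);
  ractM : forall m y y', ract m (y * y') = ract (ract m y) y';
  lractA : forall x m y, ract (lact x m) y = lact x (ract m y)
}.

#[short(type="bimodType")]
HB.structure Definition Bimodule (K : pzRingType) (A B : pzAlgType K) :=
  {M of GRing.Lmodule K M & isBimodule K A B M}.

Notation "x *:l m" := (lact x m) (at level 40, left associativity) : ring_scope.
Notation "m *:r y" := (ract m y) (at level 40, left associativity) : ring_scope.

Section Subbimodule.
Variables (K : pzRingType) (A B : pzAlgType K) (M : bimodType A B).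

Definition bimod_closed (S : {pred M}) := [/\ submod_closed S,
  forall x, {in S, forall m, x *:l m \in S} &
  forall y, {in S, forall m, m *:r y \in S}].

Definition bispan (S : set M) : {pred M} := fun m =>
  `[< forall U : {pred M}, bimod_closed U -> (forall s, S s -> s \in U) ->
        m \in U >].

Lemma bispan_bimod_closed S : bimod_closed (bispan S).
Proof.
split; first split.
- by apply/asboolP => U [[]].
- move=> a u v /asboolP Su /asboolP Sv; apply/asboolP => U Uc SU.
  by case: (Uc) => -[_ +] _ _; apply; [exact: Su | exact: Sv].
- move=> x m /asboolP Sm; apply/asboolP => U Uc SU.
  by case: (Uc) => _ + _; apply; exact: Sm.
- move=> y m /asboolP Sm; apply/asboolP => U Uc SU.
  by case: (Uc) => _ _; apply; exact: Sm.
Qed.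

Lemma mem_bispan (S : set M) s : S s -> s \in bispan S.
Proof. by move=> Ss; apply/asboolP => U _; apply. Qed.

Lemma bispan_submod_closed S : submod_closed (bispan S).
Proof. by case: (bispan_bimod_closed S). Qed.

HB.instance Definition _ S := GRing.isSubmodClosed.Build K M (bispan S)
  (bispan_submod_closed S).

Variable S : set M.

Definition bimod_quot := lmod_quot (bispan S).

HB.instance Definition _ := GRing.Lmodule.on bimod_quot.

Definition bimod_pi : M -> bimod_quot := lmod_pi (bispan S).

HB.instance Definition _ := GRing.Linear.on bimod_pi.

Lemma bimod_piP v w : reflect (bimod_pi v = bimod_pi w) (v - w \in bispan S).
Proof. exact: lmod_piP. Qed.

Lemma bimod_piK (q : bimod_quot) : bimod_pi (repr q) = q.
Proof. exact: lmod_piK. Qed.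

Definition bimod_quot_lact (x : A) (q : bimod_quot) : bimod_quot :=
  bimod_pi (x *:l repr q).
Definition bimod_quot_ract (q : bimod_quot) (y : B) : bimod_quot :=
  bimod_pi (repr q *:r y).

Lemma bimod_quot_lactE x m : bimod_quot_lact x (bimod_pi m) = bimod_pi (x *:l m).
Proof.
apply/bimod_piP; case: (bispan_bimod_closed S) => _ + _ => /(_ x).
have lB u v : x *:l u - x *:l v = x *:l (u - v).
  by rewrite addrC -scaleN1r -lact_linearr scaleN1r addrC.
by rewrite lB; apply; apply/bimod_piP; rewrite bimod_piK.
Qed.

Lemma bimod_quot_ractE m y : bimod_quot_ract (bimod_pi m) y = bimod_pi (m *:r y).
Proof.
apply/bimod_piP; case: (bispan_bimod_closed S) => _ _ /(_ y).
have rB u v : u *:r y - v *:r y = (u - v) *:r y.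
  by rewrite addrC -scaleN1r -ract_linearl scaleN1r addrC.
by rewrite rB; apply; apply/bimod_piP; rewrite bimod_piK.
Qed.

Let lactE := bimod_quot_lactE.
Let ractE := bimod_quot_ractE.

Lemma bimod_quot_lact_linearl q : linear (bimod_quot_lact^~ q).
Proof. by move=> a x y; rewrite -[q]bimod_piK !lactE lact_linearl linearP. Qed.

Lemma bimod_quot_lact_linearr x : linear (bimod_quot_lact x).
Proof.
move=> a p q; rewrite -[p]bimod_piK -[q]bimod_piK -linearP !lactE.
by rewrite lact_linearr linearP.
Qed.

Lemma bimod_quot_ract_linearl y : linear (bimod_quot_ract^~ y).
Proof.
move=> a p q; rewrite -[p]bimod_piK -[q]bimod_piK -linearP !ractE.
by rewrite ract_linearl linearP.
Qed.

Lemma bimod_quot_ract_linearr q : linear (bimod_quot_ract q).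
Proof. by move=> a x y; rewrite -[q]bimod_piK !ractE ract_linearr linearP. Qed.

Lemma bimod_quot_lact1 q : bimod_quot_lact 1 q = q.
Proof. by rewrite -[q]bimod_piK lactE lact1. Qed.

Lemma bimod_quot_ract1 q : bimod_quot_ract q 1 = q.
Proof. by rewrite -[q]bimod_piK ractE ract1. Qed.

Lemma bimod_quot_lactM x x' q :
  bimod_quot_lact (x * x') q = bimod_quot_lact x (bimod_quot_lact x' q).
Proof. by rewrite -[q]bimod_piK !lactE lactM. Qed.

Lemma bimod_quot_ractM q y y' :
  bimod_quot_ract q (y * y') = bimod_quot_ract (bimod_quot_ract q y) y'.
Proof. by rewrite -[q]bimod_piK !ractE ractM. Qed.

Lemma bimod_quot_lractA x q y :
  bimod_quot_ract (bimod_quot_lact x q) y =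
  bimod_quot_lact x (bimod_quot_ract q y).
Proof. by rewrite -[q]bimod_piK !(lactE, ractE) lractA. Qed.

HB.instance Definition _ := isBimodule.Build K A B bimod_quot
  bimod_quot_lact_linearl bimod_quot_lact_linearr
  bimod_quot_ract_linearl bimod_quot_ract_linearr
  bimod_quot_lact1 bimod_quot_ract1
  bimod_quot_lactM bimod_quot_ractM bimod_quot_lractA.

Lemma bimod_pi_lact x m : bimod_pi (x *:l m) = x *:l bimod_pi m.
Proof. by rewrite -lactE. Qed.

Lemma bimod_pi_ract m y : bimod_pi (m *:r y) = bimod_pi m *:r y.
Proof. by rewrite -ractE. Qed.

End Subbimodule.

Section Tensor.
Variables (K : comNzRingType) (U V : lmodType K).

Definition tensor_rel : set {freeg (U * V) / K} :=
  [set r | exists (a : K) (u u' : U) (v : V),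
     r = << (a *: u + u', v) >> - (a *: << (u, v) >> + << (u', v) >>)] `|`
  [set r | exists (a : K) (u : U) (v v' : V),
     r = << (u, a *: v + v') >> - (a *: << (u, v) >> + << (u, v') >>)].

Definition tensor := lmod_quot (lspan tensor_rel).

HB.instance Definition _ := GRing.Lmodule.on tensor.

Definition tens (u : U) (v : V) : tensor := lmod_pi (lspan tensor_rel) << (u, v) >>.

Lemma tens_linearl v : linear (tens^~ v).
Proof.
move=> a u u'; rewrite /tens -linearP; apply/lmod_piP/mem_lspan.
by left; exists a, u, u', v.
Qed.

Lemma tens_linearr u : linear (tens u).
Proof.
move=> a v v'; rewrite /tens -linearP; apply/lmod_piP/mem_lspan.
by right; exists a, u, v, v'.
Qed.

Variable W : lmodType K.

Lemma fglift_is_linear (X : choiceType) (h : X -> W) : linear (fglift h).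
Proof.
have hD := lift_is_additive h.
pose g : {additive {freeg X / K} -> W} :=
  HB.pack (fglift h) (GRing.isZmodMorphism.Build _ _ (fglift h) hD).
have gU k x : g << k *g x >> = k *: h x by exact: liftU.
suff gZ a D : g (a *: D) = a *: g D.
  by move=> a D D'; rewrite -[fglift h]/(g : _ -> _) raddfD gZ.
have [s [c ->]] : exists s (c : X -> K), D = \sum_(x <- s) << c x *g x >>.
  by exists (dom D), (fun x => coeff x D); rewrite freeg_sumE.
rewrite (scaler_sumr a s xpredT (fun x => << c x *g x >> : {freeg X / K})).
rewrite !raddf_sum; apply: eq_bigr => x _.
have -> : a *: << c x *g x >> = << a * c x *g x >> :> {freeg X / K}.
  by apply/eqP/freeg_eqP => z; rewrite coeffZ !coeffU mulrA.
by rewrite !gU -scalerA.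
Qed.

Lemma tensor_ext (f g : tensor -> W) : linear f -> linear g ->
  (forall u v, f (tens u v) = g (tens u v)) -> f =1 g.
Proof.
move=> lf lg fg t.
pose F : {linear tensor -> W} := HB.pack f (GRing.isLinear.Build _ _ _ _ f lf).
pose G : {linear tensor -> W} := HB.pack g (GRing.isLinear.Build _ _ _ _ g lg).
rewrite -[f]/(F : _ -> _) -[g]/(G : _ -> _) -[t]lmod_piK.
rewrite -(freeg_sumE (repr t)) !linear_sum; apply: eq_bigr => -[u v] _.
have -> : << coeff (u, v) (repr t) *g (u, v) >> =
          coeff (u, v) (repr t) *: << (u, v) >> :> {freeg (U * V) / K}.
  by apply/eqP/freeg_eqP => z; rewrite coeffZ !coeffU mul1r.
by rewrite !linearZ /=; congr (_ *: _); apply: fg.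
Qed.

Definition tensor_lift (f : U -> V -> W) (t : tensor) : W :=
  fglift (fun p => f p.1 p.2) (repr t).

Section Lift.
Variable f : U -> V -> W.
Hypothesis f_linearl : forall v, linear (f^~ v).
Hypothesis f_linearr : forall u, linear (f u).

Lemma tensor_lift_pi D :
  tensor_lift f (lmod_pi (lspan tensor_rel) D) = fglift (fun p => f p.1 p.2) D.
Proof.
set F := fglift _.
pose G : {linear {freeg (U * V) / K} -> W} :=
  HB.pack F (GRing.isLinear.Build _ _ _ _ F (fglift_is_linear _)).
have kerF D0 : D0 \in lspan tensor_rel -> F D0 = 0.
  move/asboolP/(_ (fun D0 => F D0 == 0)) => H; apply/eqP; apply: H.
    split=> [|a x y]; rewrite !unfold_in -[F]/(G : _ -> _) ?linear0 //.
    by rewrite linearP => /eqP-> /eqP->; rewrite scaler0 addr0.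
  have FU p : F << p >> = f p.1 p.2 by rewrite /F liftU scale1r.
  move=> r; rewrite unfold_in => -[[a [u [u' [v ->]]]]|[a [u [v [v' ->]]]]];
    rewrite -[F]/(G : _ -> _) linearB linearP /= !FU /=.
    by rewrite f_linearl subrr.
  by rewrite f_linearr subrr.
rewrite /tensor_lift -/F; apply/eqP; rewrite -subr_eq0 -[F]/(G : _ -> _).
by rewrite -linearB; apply/eqP/kerF/lmod_piP; rewrite lmod_piK.
Qed.

Lemma tensor_liftE u v : tensor_lift f (tens u v) = f u v.
Proof. by rewrite tensor_lift_pi liftU scale1r. Qed.

Lemma tensor_lift_is_linear : linear (tensor_lift f).
Proof.
move=> a s t; rewrite -[s]lmod_piK -[t]lmod_piK -linearP !tensor_lift_pi.
exact: fglift_is_linear.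
Qed.

End Lift.
End Tensor.

Section TensorBimodule.
Variables (K : comNzRingType) (A : pzAlgType K).
Local Notation T := (tensor A A).

Definition tensor_lact (x : A) : T -> T :=
  tensor_lift (fun u v : A => tens (x * u) v).
Definition tensor_ract (t : T) (y : A) : T :=
  tensor_lift (fun u v : A => tens u (v * y)) t.
Definition tensor_mul : T -> A := tensor_lift (fun u v : A => u * v).

Lemma tensor_lactE x u v : tensor_lact x (tens u v) = tens (x * u) v.
Proof.
apply: (tensor_liftE (f := fun u v : A => tens (x * u) v)) => [w a p q|w a p q].
  by rewrite /= mulr_linearr tens_linearl.
by rewrite tens_linearr.
Qed.

Lemma tensor_lact_linearr x : linear (tensor_lact x).
Proof.
apply: tensor_lift_is_linear => [w a p q|w a p q].
  by rewrite /= mulr_linearr tens_linearl.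
by rewrite tens_linearr.
Qed.

Lemma tensor_ractE u v y : tensor_ract (tens u v) y = tens u (v * y).
Proof.
apply: (tensor_liftE (f := fun u v : A => tens u (v * y))) => [w a p q|w a p q].
  by rewrite tens_linearl.
by rewrite /= mulr_linearl tens_linearr.
Qed.

Lemma tensor_ract_linearl y : linear (tensor_ract^~ y).
Proof.
apply: tensor_lift_is_linear => [w a p q|w a p q].
  by rewrite tens_linearl.
by rewrite /= mulr_linearl tens_linearr.
Qed.

Lemma tensor_mulE u v : tensor_mul (tens u v) = u * v.
Proof.
by apply: (tensor_liftE (f := fun u v : A => u * v)) => w;
  [apply: mulr_linearl | apply: mulr_linearr].
Qed.

Lemma tensor_mul_is_linear : linear tensor_mul.
Proof.
by apply: tensor_lift_is_linear => w;
  [apply: mulr_linearl | apply: mulr_linearr].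
Qed.

HB.instance Definition _ :=
  GRing.isLinear.Build K T A *:%R tensor_mul tensor_mul_is_linear.

Lemma tensor_lact_linearl t : linear (tensor_lact^~ t).
Proof.
move=> a x y; apply: (tensor_ext (f := tensor_lact (a *: x + y))
  (g := fun t => a *: tensor_lact x t + tensor_lact y t)) => [|b p q|u v].
- exact: tensor_lact_linearr.
- rewrite !tensor_lact_linearr !scalerDr !scalerA [a * b]mulrC.
  by rewrite addrACA.
- by rewrite !tensor_lactE mulr_linearl tens_linearl.
Qed.

Lemma tensor_ract_linearr t : linear (tensor_ract t).
Proof.
move=> a x y; apply: (tensor_ext (f := tensor_ract^~ (a *: x + y))
  (g := fun t => a *: tensor_ract t x + tensor_ract t y)) => [|b p q|u v].
- exact: tensor_ract_linearl.
- rewrite !tensor_ract_linearl !scalerDr !scalerA [a * b]mulrC.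
  by rewrite addrACA.
- by rewrite !tensor_ractE mulr_linearr tens_linearr.
Qed.

Lemma tensor_lact1 t : tensor_lact 1 t = t.
Proof.
apply: (tensor_ext (g := id)) => [||u v]; first exact: tensor_lact_linearr.
  by [].
by rewrite tensor_lactE mul1r.
Qed.

Lemma tensor_ract1 t : tensor_ract t 1 = t.
Proof.
apply: (tensor_ext (f := tensor_ract^~ 1) (g := id)) => [||u v].
- exact: tensor_ract_linearl.
- by [].
- by rewrite tensor_ractE mulr1.
Qed.

Lemma tensor_lactM x x' t :
  tensor_lact (x * x') t = tensor_lact x (tensor_lact x' t).
Proof.
apply: (tensor_ext (g := tensor_lact x \o tensor_lact x')) => [|a p q|u v] /=.
- exact: tensor_lact_linearr.
- by rewrite !tensor_lact_linearr.
- by rewrite !tensor_lactE mulrA.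
Qed.

Lemma tensor_ractM t y y' :
  tensor_ract t (y * y') = tensor_ract (tensor_ract t y) y'.
Proof.
apply: (tensor_ext (f := tensor_ract^~ (y * y'))
  (g := fun t => tensor_ract (tensor_ract t y) y')) => [|a p q|u v].
- exact: tensor_ract_linearl.
- by rewrite !tensor_ract_linearl.
- by rewrite !tensor_ractE mulrA.
Qed.

Lemma tensor_lractA x t y :
  tensor_ract (tensor_lact x t) y = tensor_lact x (tensor_ract t y).
Proof.
apply: (tensor_ext (f := fun t => tensor_ract (tensor_lact x t) y)
  (g := fun t => tensor_lact x (tensor_ract t y))) => [a p q|a p q|u v].
- by rewrite tensor_lact_linearr tensor_ract_linearl.
- by rewrite tensor_ract_linearl tensor_lact_linearr.
- by rewrite tensor_lactE !tensor_ractE tensor_lactE.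
Qed.

HB.instance Definition _ := isBimodule.Build K A A (tensor A A)
  tensor_lact_linearl tensor_lact_linearr
  tensor_ract_linearl tensor_ract_linearr
  tensor_lact1 tensor_ract1 tensor_lactM tensor_ractM tensor_lractA.

Lemma lact_tens (x u v : A) : x *:l tens u v = tens (x * u) v.
Proof. exact: tensor_lactE. Qed.

Lemma ract_tens (u v y : A) : tens u v *:r y = tens u (v * y).
Proof. exact: tensor_ractE. Qed.

Lemma tensor_mul_lact x t : tensor_mul (x *:l t) = x * tensor_mul t.
Proof.
apply: (tensor_ext (f := fun t : T => tensor_mul (x *:l t))
  (g := fun t => x * tensor_mul t)) => [a p q|a p q|u v].
- by rewrite lact_linearr linearP.
- by rewrite linearP mulr_linearr.
- by rewrite lact_tens !tensor_mulE mulrA.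
Qed.

Lemma tensor_mul_ract t y : tensor_mul (t *:r y) = tensor_mul t * y.
Proof.
apply: (tensor_ext (f := fun t : T => tensor_mul (t *:r y))
  (g := fun t => tensor_mul t * y)) => [a p q|a p q|u v].
- by rewrite ract_linearl linearP.
- by rewrite linearP mulr_linearl.
- by rewrite ract_tens !tensor_mulE mulrA.
Qed.

End TensorBimodule.

Section UniversalForms.
Variables (K : comNzRingType) (A : pzAlgType K).

Definition mul_ker : {pred tensor A A} := fun t => tensor_mul t == 0.

Lemma mul_ker_submod_closed : submod_closed mul_ker.
Proof.
split=> [|a s t /eqP s0 /eqP t0]; first by rewrite unfold_in linear0.
by rewrite unfold_in tensor_mul_is_linear s0 t0 scaler0 addr0.
Qed.

HB.instance Definition _ :=
  GRing.isSubmodClosed.Build K (tensor A A) mul_ker mul_ker_submod_closed.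

Record OmegaU := MkOmegaU {
  OmegaU_val :> tensor A A;
  _ : OmegaU_val \in mul_ker
}.

HB.instance Definition _ := [isSub for OmegaU_val].
HB.instance Definition _ := [Choice of OmegaU by <:].
HB.instance Definition _ := [SubChoice_isSubLmodule of OmegaU by <:].

Lemma OmegaU_mul (w : OmegaU) : tensor_mul (val w) = 0.
Proof. by apply/eqP; exact: (valP w). Qed.

Lemma OmegaU_lact_subproof (x : A) (w : OmegaU) : x *:l val w \in mul_ker.
Proof. by rewrite unfold_in tensor_mul_lact OmegaU_mul mulr0. Qed.

Lemma OmegaU_ract_subproof (w : OmegaU) (y : A) : val w *:r y \in mul_ker.
Proof. by rewrite unfold_in tensor_mul_ract OmegaU_mul mul0r. Qed.

Definition OmegaU_lact (x : A) (w : OmegaU) : OmegaU :=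
  MkOmegaU (OmegaU_lact_subproof x w).
Definition OmegaU_ract (w : OmegaU) (y : A) : OmegaU :=
  MkOmegaU (OmegaU_ract_subproof w y).

Lemma OmegaU_lact_linearl w : linear (OmegaU_lact^~ w).
Proof. by move=> a x y; apply: val_inj; rewrite linearP /= lact_linearl. Qed.

Lemma OmegaU_lact_linearr x : linear (OmegaU_lact x).
Proof. by move=> a v w; apply: val_inj; rewrite !linearP /= lact_linearr. Qed.

Lemma OmegaU_ract_linearl y : linear (OmegaU_ract^~ y).
Proof. by move=> a v w; apply: val_inj; rewrite !linearP /= ract_linearl. Qed.

Lemma OmegaU_ract_linearr w : linear (OmegaU_ract w).
Proof. by move=> a x y; apply: val_inj; rewrite linearP /= ract_linearr. Qed.

Lemma OmegaU_lact1 w : OmegaU_lact 1 w = w.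
Proof. by apply: val_inj; rewrite /= lact1. Qed.

Lemma OmegaU_ract1 w : OmegaU_ract w 1 = w.
Proof. by apply: val_inj; rewrite /= ract1. Qed.

Lemma OmegaU_lactM x x' w :
  OmegaU_lact (x * x') w = OmegaU_lact x (OmegaU_lact x' w).
Proof. by apply: val_inj; rewrite /= lactM. Qed.

Lemma OmegaU_ractM w y y' :
  OmegaU_ract w (y * y') = OmegaU_ract (OmegaU_ract w y) y'.
Proof. by apply: val_inj; rewrite /= ractM. Qed.

Lemma OmegaU_lractA x w y :
  OmegaU_ract (OmegaU_lact x w) y = OmegaU_lact x (OmegaU_ract w y).
Proof. by apply: val_inj; rewrite /= lractA. Qed.

HB.instance Definition _ := isBimodule.Build K A A OmegaU
  OmegaU_lact_linearl OmegaU_lact_linearr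
  OmegaU_ract_linearl OmegaU_ract_linearr
  OmegaU_lact1 OmegaU_ract1 OmegaU_lactM OmegaU_ractM OmegaU_lractA.

Lemma dU_subproof (x : A) : tens (1 : A) x - tens x (1 : A) \in mul_ker.
Proof. by rewrite unfold_in linearB /= !tensor_mulE mul1r mulr1 subrr. Qed.

Definition dU (x : A) : OmegaU := MkOmegaU (dU_subproof x).

Definition center_commutators : set OmegaU :=
  [set e | exists z w, center A z /\ e = z *:l w - w *:r z].

Definition OmegaZ := bimod_quot center_commutators.

HB.instance Definition _ := Bimodule.on OmegaZ.

Definition pZ : OmegaU -> OmegaZ := bimod_pi center_commutators.

Definition dZ (x : A) : OmegaZ := pZ (dU x).

End UniversalForms.

(* Main.v *)
From HB Require Import structures.
Require Import Defs.
From mathcomp Require Import all_boot all_order all_algebra.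
From mathcomp Require Import boolp classical_sets reals complex.

(** Everything is functorial.  The map [phi (x) phi] from [A (x) A] to
    [B (x) B] is compatible with the products, so it sends [Omega_u A] to
    [Omega_u B]; it is equivariant along [phi] and commutes with [d_u]
    because [phi 1 = 1] ([OmegaU_map_lact], [OmegaU_map_ract],
    [OmegaU_map_dU]).  As [phi] carries the center of [A] into the center of
    [B], a generator [z w - w z] goes to an element of the same form, hence the
    subbimodule spanned by these generators is killed after projecting to
    [Omega_Z B] ([OmegaU_map_center_commutators]) and the map descends to the
    quotients ([OmegaZ_mapE]).

    Uniqueness holds because [Omega_u A] is generated by exact forms as a left
    module: since [u (x) v = u (d_u v) + uv (x) 1], a tensor
    [sum_i u_i (x) v_i] of zero product equals [sum_i u_i (d_u v_i)].  An
    equivariant linear map is thus determined by its values on the [d_Z v]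
    ([OmegaZ_ext]). *)

Set Implicit Arguments.
Unset Strict Implicit.
Unset Printing Implicit Defensive.

Import GRing.Theory.

Local Open Scope ring_scope.
Local Open Scope classical_set_scope.

Lemma lactB (K : pzRingType) (A B : pzAlgType K) (M : bimodType A B)
    (x : A) (s t : M) : x *:l (s - t) = x *:l s - x *:l t.
Proof. by rewrite addrC -scaleN1r lact_linearr scaleN1r addrC. Qed.

Section Exact.
Variables (K : comNzRingType) (A : pzAlgType K).

Lemma OmegaU_valP (a : K) (v w : OmegaU A) :
  OmegaU_val (a *: v + w) = a *: OmegaU_val v + OmegaU_val w.
Proof. exact: (linearP (val : OmegaU A -> tensor A A)). Qed.

(** The left-linear map [u (x) v |-> u (d_u v)]: a retraction of the inclusion
    of [Omega_u A] in [A (x) A]. *)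
Definition exact_part : tensor A A -> OmegaU A :=
  tensor_lift (fun u v : A => u *:l dU v).

Lemma dU_is_linear : linear (@dU K A).
Proof.
move=> a x y; apply: val_inj; rewrite linearP /=.
by rewrite tens_linearl tens_linearr scalerBr opprD addrACA.
Qed.

Let exact_linearl (v : A) : linear (fun u : A => u *:l dU v).
Proof. exact: lact_linearl. Qed.

Let exact_linearr (u : A) : linear (fun v : A => u *:l dU v).
Proof. by move=> a v v'; rewrite dU_is_linear lact_linearr. Qed.

Lemma exact_part_is_linear : linear exact_part.
Proof. exact: tensor_lift_is_linear exact_linearl exact_linearr. Qed.

Lemma exact_part_tens u v : exact_part (tens u v) = u *:l dU v.
Proof. exact: (tensor_liftE exact_linearl exact_linearr). Qed.

Lemma exact_part_val (t : tensor A A) :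
  OmegaU_val (exact_part t) = t - tens (tensor_mul t) (1 : A).
Proof.
apply: (tensor_ext (f := fun t => OmegaU_val (exact_part t))
  (g := fun t => t - tens (tensor_mul t) (1 : A))) => [a s r|a s r|u v].
- by rewrite exact_part_is_linear OmegaU_valP.
- by rewrite linearP tens_linearl scalerBr opprD addrACA.
- rewrite exact_part_tens tensor_mulE /=.
  by rewrite lactB !lact_tens mulr1.
Qed.

Lemma exact_partK (w : OmegaU A) : exact_part (OmegaU_val w) = w.
Proof.
apply: val_inj; rewrite /= exact_part_val (OmegaU_mul w).
(* Linearity on [- 0 + 0] gives [0 (x) 1 = 0]. *)
have := tens_linearl (1 : A) (-1) (0 : A) 0.
rewrite scaler0 addr0 scaleN1r addNr => ->.
by rewrite subr0.
Qed.

(** Every universal form is its own image under [exact_part], hence a sum of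
    products [u (d_u v)]. *)
Lemma OmegaU_ext (W : lmodType K) (f g : OmegaU A -> W) :
  linear f -> linear g ->
  (forall u v : A, f (u *:l dU v) = g (u *:l dU v)) -> f =1 g.
Proof.
move=> lf lg fg w; rewrite -[w]exact_partK.
apply: (tensor_ext (f := f \o exact_part) (g := g \o exact_part))
  => [a s t|a s t|u v] /=.
- by rewrite exact_part_is_linear lf.
- by rewrite exact_part_is_linear lg.
- by rewrite exact_part_tens.
Qed.

Lemma OmegaZ_ext (W : lmodType K) (f g : OmegaZ A -> W) :
  linear f -> linear g ->
  (forall u v : A, f (u *:l dZ v) = g (u *:l dZ v)) -> f =1 g.
Proof.
move=> lf lg fg q; rewrite -[q]bimod_piK.
apply: (OmegaU_ext (f := f \o @pZ K A) (g := g \o @pZ K A))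
  => [a s t|a s t|u v] /=.
- by rewrite [pZ _]linearP lf.
- by rewrite [pZ _]linearP lg.
- by rewrite [pZ _]bimod_pi_lact fg.
Qed.

End Exact.

Section Functoriality.
Variables (K : comNzRingType) (A B : pzAlgType K) (phi : {rmorphism A -> B}).
Hypothesis phi_scalable : scalable phi.

Let phi_linear : linear phi.
Proof. by move=> a x y; rewrite rmorphD phi_scalable. Qed.

Definition tensor_map : tensor A A -> tensor B B :=
  tensor_lift (fun u v : A => tens (phi u) (phi v)).

Let tens_phi_linearl (v : A) : linear (fun u : A => tens (phi u) (phi v)).
Proof. by move=> a u u'; rewrite phi_linear tens_linearl. Qed.

Let tens_phi_linearr (u : A) : linear (fun v : A => tens (phi u) (phi v)).
Proof. by move=> a v v'; rewrite phi_linear tens_linearr. Qed.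

Lemma tensor_map_is_linear : linear tensor_map.
Proof. exact: tensor_lift_is_linear tens_phi_linearl tens_phi_linearr. Qed.

Lemma tensor_map_tens u v : tensor_map (tens u v) = tens (phi u) (phi v).
Proof. exact: (tensor_liftE tens_phi_linearl tens_phi_linearr). Qed.

Lemma tensor_map_lact x t : tensor_map (x *:l t) = phi x *:l tensor_map t.
Proof.
apply: (tensor_ext (f := fun t => tensor_map (x *:l t))
  (g := fun t => phi x *:l tensor_map t)) => [a p q|a p q|u v].
- by rewrite lact_linearr tensor_map_is_linear.
- by rewrite tensor_map_is_linear lact_linearr.
- by rewrite lact_tens !tensor_map_tens lact_tens rmorphM.
Qed.

Lemma tensor_map_ract t y : tensor_map (t *:r y) = tensor_map t *:r phi y.
Proof.
apply: (tensor_ext (f := fun t => tensor_map (t *:r y))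
  (g := fun t => tensor_map t *:r phi y)) => [a p q|a p q|u v].
- by rewrite ract_linearl tensor_map_is_linear.
- by rewrite tensor_map_is_linear ract_linearl.
- by rewrite ract_tens !tensor_map_tens ract_tens rmorphM.
Qed.

Lemma tensor_map_mul t : tensor_mul (tensor_map t) = phi (tensor_mul t).
Proof.
apply: (tensor_ext (f := fun t => tensor_mul (tensor_map t))
  (g := fun t => phi (tensor_mul t))) => [a p q|a p q|u v].
- by rewrite tensor_map_is_linear linearP.
- by rewrite linearP phi_linear.
- by rewrite tensor_map_tens !tensor_mulE rmorphM.
Qed.

Lemma tensor_map_mul_ker (w : OmegaU A) : tensor_map w \in @mul_ker K B.
Proof. by rewrite unfold_in tensor_map_mul (OmegaU_mul w) rmorph0. Qed.

Definition OmegaU_map (w : OmegaU A) : OmegaU B :=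
  MkOmegaU (tensor_map_mul_ker w).

Lemma OmegaU_map_is_linear : linear OmegaU_map.
Proof.
by move=> a v w; apply: val_inj; rewrite [RHS]linearP /= -tensor_map_is_linear -OmegaU_valP.
Qed.

Lemma OmegaU_map_lact x w : OmegaU_map (x *:l w) = phi x *:l OmegaU_map w.
Proof. by apply: val_inj; rewrite /= tensor_map_lact. Qed.

Lemma OmegaU_map_ract w y : OmegaU_map (w *:r y) = OmegaU_map w *:r phi y.
Proof. by apply: val_inj; rewrite /= tensor_map_ract. Qed.

HB.instance Definition _ := GRing.isLinear.Build K (tensor A A) (tensor B B) *:%R
  tensor_map tensor_map_is_linear.
HB.instance Definition _ := GRing.isLinear.Build K (OmegaU A) (OmegaU B) *:%R
  OmegaU_map OmegaU_map_is_linear.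

Lemma OmegaU_map_dU x : OmegaU_map (dU x) = dU (phi x).
Proof. by apply: val_inj; rewrite /= linearB /= !tensor_map_tens rmorph1. Qed.

Hypothesis phi_center : phi @` center A `<=` center B.

(** The preimage of the subbimodule [[Z(B), Omega_u B]] is a subbimodule, so
    the generators suffice; on them, [phi z] is central. *)
Lemma OmegaU_map_center_commutators w :
  w \in bispan (@center_commutators K A) ->
  OmegaU_map w \in bispan (@center_commutators K B).
Proof.
have [[S0 Slin] Sl Sr] := bispan_bimod_closed (@center_commutators K B).
pose U : {pred OmegaU A} :=
  fun w => OmegaU_map w \in bispan (@center_commutators K B).
move=> /asboolP /(_ U); apply.
  split=> [|x m|y m]; first split=> [|a u v].
  - by rewrite unfold_in linear0.
  - by rewrite !unfold_in linearP; apply: Slin.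
  - by rewrite !unfold_in OmegaU_map_lact; apply: Sl.
  - by rewrite !unfold_in OmegaU_map_ract; apply: Sr.
move=> _ [z [v [zA ->]]]; rewrite unfold_in; apply: mem_bispan.
exists (phi z), (OmegaU_map v); split; first by apply: phi_center; exists z.
by rewrite linearB /= OmegaU_map_lact OmegaU_map_ract.
Qed.

Definition OmegaZ_map (q : OmegaZ A) : OmegaZ B := pZ (OmegaU_map (repr q)).

Lemma OmegaZ_mapE w : OmegaZ_map (pZ w) = pZ (OmegaU_map w).
Proof.
apply/bimod_piP; rewrite -linearB; apply: OmegaU_map_center_commutators.
by apply/bimod_piP; rewrite bimod_piK.
Qed.

Lemma OmegaZ_map_is_linear : linear OmegaZ_map.
Proof.
move=> a p q; rewrite -[p]bimod_piK -[q]bimod_piK.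
by rewrite -linearP !OmegaZ_mapE linearP [pZ _]linearP.
Qed.

Lemma OmegaZ_map_equivariant x y w :
  OmegaZ_map (x *:l w *:r y) = phi x *:l OmegaZ_map w *:r phi y.
Proof.
rewrite -[w]bimod_piK -bimod_pi_lact -bimod_pi_ract !OmegaZ_mapE.
by rewrite OmegaU_map_ract OmegaU_map_lact [pZ _]bimod_pi_ract bimod_pi_lact.
Qed.

Lemma OmegaZ_map_dZ x : OmegaZ_map (dZ x) = dZ (phi x).
Proof. by rewrite [LHS]OmegaZ_mapE OmegaU_map_dU. Qed.

End Functoriality.

Theorem proposition4 (R : realType) (A B : pzAlgType R[i])
    (phi : {rmorphism A -> B}) (phi_scalable : scalable phi)
    (phi_center : phi @` center A `<=` center B) :
  exists! Phi : OmegaZ A -> OmegaZ B,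
    [/\ linear Phi,
        forall (x y : A) (w : OmegaZ A),
          Phi (x *:l w *:r y) = phi x *:l Phi w *:r phi y
      & @dZ _ B \o phi = Phi \o @dZ _ A].
Proof.
pose Omega_phi := OmegaZ_map phi_scalable.
have Omega_phi_linear : linear Omega_phi by exact: OmegaZ_map_is_linear.
exists Omega_phi; split.
  split=> [//|x y w|]; first exact: OmegaZ_map_equivariant.
  by apply/funext => x /=; rewrite /Omega_phi OmegaZ_map_dZ.
move=> Psi [Psi_linear Psi_equivariant Psi_dZ].
apply/funext; apply: OmegaZ_ext => // u v.
(* The trivial right factor 1 makes the two-sided equivariance applicable. *)
rewrite -[u *:l _]ract1 Psi_equivariant [LHS]OmegaZ_map_equivariant //.
rewrite OmegaZ_map_dZ //; congr (_ *:l _ *:r _).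
exact: (congr1 (fun f => f v) Psi_dZ).
Qed.
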